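(* For any integers $n\ge 3$ and $k\ge 2$, there does not exist a lattice tiling of $\mathbb{Z}^n$ by $\mathcal{B}(n,2,k,k-1)$.
   Context: For integers $n\ge t\ge 1$ and $k_1\ge k_2\ge 0$, the limited-magnitude error ball is $\mathcal{B}(n,t,k_1,k_2)=\{\mathbf{a}=(a_1,\dots,a_n)\in\mathbb{Z}^n : a_i\in[-k_2,k_1] \text{ for all } i,\ \mathrm{wt}(\mathbf{a})\le t\}$, where $\mathrm{wt}(\mathbf{a})$ is the Hamming weight. A set $C\subset\mathbb{Z}^n$ gives a tiling of $\mathbb{Z}^n$ by $\mathcal{B}$ if the translates $\mathcal{B}+c$, $c\in C$, partition $\mathbb{Z}^n$; it is a lattice tiling if moreover $C$ is a lattice (an additive subgroup of $\mathbb{Z}^n$). *)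

(* Defs.v *)
From mathcomp Require Import all_boot all_order all_algebra.
From mathcomp Require Import classical_sets.
Set Implicit Arguments.
Unset Strict Implicit.
Unset Printing Implicit Defensive.
Import Order.TTheory GRing.Theory Num.Theory.
Local Open Scope classical_set_scope.
Local Open Scope ring_scope.

Definition wt (n : nat) (a : 'rV[int]_n) : nat := #|[pred i | a 0 i != 0]|.

Definition error_ball (n t : nat) (k1 k2 : int) : set 'rV[int]_n :=
  [set a : 'rV[int]_n | (forall i, - k2 <= a 0 i <= k1) /\ (wt a <= t)%N].
Arguments error_ball : clear implicits.

Definition translate (n : nat) (B : set 'rV[int]_n) (c : 'rV[int]_n) :
    set 'rV[int]_n :=
  [set b + c | b in B].

(* [partition] is indexed by c: distinct c in C must give disjoint translates. *)
Definition tiling (n : nat) (B C : set 'rV[int]_n) : Prop :=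
  partition C (translate B) setT.

Definition lattice_tiling (n : nat) (B C : set 'rV[int]_n) : Prop :=
  tiling B C /\ zmod_closed (mem C).

(* Main.v *)
Require Import Defs.
From mathcomp Require Import all_boot all_order all_algebra.
From mathcomp Require Import boolp classical_sets fintype finset.
From mathcomp Require Import ring zify.
Set Implicit Arguments.
Unset Strict Implicit.
Unset Printing Implicit Defensive.
Import Order.TTheory GRing.Theory Num.Theory.
Local Open Scope classical_set_scope.
Local Open Scope ring_scope.

(** Let [C] be a tiling lattice: every vector is congruent modulo [C] to exactly
    one element of the ball, whose nonzero coefficients lie in [[-(k-1), k]].

    Suppose [2k e_i] is not in [C], and for each [j <> i], [a = 1, -1] look at the
    ball element [b] congruent to [-(k e_i + a e_j)]. Uniqueness forces either
    [b = k e_i + y e_r] or [b = k e_l + y e_r] with [l <> i, j]. In the first case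
    [2k e_i = - a e_j - y e_r] modulo [C], which holds for at most 3 pairs
    [(j, a)]; in the second case [l] determines [(j, a)], so there are at most
    [n - 1] pairs. Hence [2 (n - 1) <= 3 + (n - 1)], i.e. [n <= 4]. But the ball
    element congruent to [e_1 + e_2 + e_3] must have two further coordinates, so
    [n >= 5].

    So every [2k e_i] is in [C]. If [b] is the ball element congruent to
    [e_1 + e_2 + 2 e_3], then [k b = k e_1 + k e_2] modulo [C], so the odd
    coordinates of [b] are exactly the first two. Thus [b = u e_1 + v e_2] and
    [(1 - u) e_1 + 2 e_3 = (v - 1) e_2] modulo [C], contradicting uniqueness. *)

(** Serves to pad a support with zero coefficients up to an exact number of indices. *)
Lemma subset_intermediate_card (T : finType) (A B : {set T}) (m : nat) :
  A \subset B -> (#|A| <= m <= #|B|)%N ->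
  exists S : {set T}, [/\ A \subset S, S \subset B & #|S| = m].
Proof.
move=> sAB /andP[]; move: {2}(m - #|A|)%N (erefl (m - #|A|)%N) => d.
elim: d A sAB => [|d IHd] A sAB dA leAm lemB.
  by exists A; split=> //; lia.
have /properP[_ [x xB xA]] : A \proper B by rewrite properEcard sAB; lia.
have sAxB : x |: A \subset B by rewrite subUset sub1set xB.
have cAx : #|x |: A| = #|A|.+1 by rewrite cardsU1 xA.
have [||//|S [sAS sSB cS]] := IHd _ sAxB; rewrite ?cAx; try lia.
by exists S; split=> //; apply: subset_trans sAS; apply: subsetUr.
Qed.

Section LatticeTiling.
Local Open Scope set_scope.

Context (n : nat) (k : int) (C : set 'rV[int]_n).
Hypothesis hn : (3 <= n)%N.
Hypothesis hk : 2 <= k.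

Local Notation ball := (error_ball n 2 k (k - 1)).
Local Notation e i := (delta_mx 0 i : 'rV[int]_n).
Local Notation coef a := (- (k - 1) <= a <= k).

Hypothesis latticeB : forall x y, C x -> C y -> C (x - y).
Hypothesis covering : forall z, exists2 b, ball b & C (z - b).
Hypothesis packing : forall x y, ball x -> ball y -> C (x - y) -> x = y.

Ltac rowring := apply/rowP=> ?; rewrite !mxE; ring.

(** * Closure properties of the lattice *)

Lemma lattice0 : C 0.
Proof.
by have [b _ Cb] := covering 0; rewrite -(subrr (0 - b)); apply: latticeB.
Qed.

Lemma latticeN x : C x -> C (- x).
Proof.
by move=> Cx; rewrite -sub0r; apply: latticeB => //; apply: lattice0.
Qed.

Lemma latticeD x y : C x -> C y -> C (x + y).
Proof.
by move=> Cx Cy; rewrite -[y]opprK; apply: latticeB => //; apply: latticeN.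
Qed.

Lemma latticeZ m x : C x -> C (m *: x).
Proof.
move=> Cx; have Cnat (p : nat) : C ((p : int) *: x).
  elim: p => [|p IHp]; first by rewrite scale0r; apply: lattice0.
  by rewrite intS scalerDl scale1r; apply: latticeD.
case: m => p; first exact: Cnat.
by rewrite NegzE scaleNr; apply/latticeN/Cnat.
Qed.

(** * Uniqueness for combinations of two unit vectors *)

Lemma ball_two_coords p q i j :
  i <> j -> coef p -> coef q -> ball (p *: e i + q *: e j).
Proof.
move=> /eqP neq_ij hp hq; split=> [t|].
  rewrite !mxE /=; case: (t =P i) => [->|_]; last by case: (t =P j) => _; lia.
  by rewrite (negbTE neq_ij); lia.
rewrite -[X in (_ <= X)%N](_ : #|[set i; j]| = 2); last by rewrite cards2 neq_ij.
apply/subset_leq_card/subsetP=> t.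
rewrite !inE !mxE /=; case: (t == i); case: (t == j) => //=.
by rewrite !mulr0 addr0 eqxx.
Qed.

Lemma ball_eq_coord c i p j q l r m s t :
    C c -> i <> j -> l <> m -> coef p -> coef q -> coef r -> coef s ->
    c = p *: e i + q *: e j - (r *: e l + s *: e m) ->
  p * (t == i)%:R + q * (t == j)%:R = r * (t == l)%:R + s * (t == m)%:R.
Proof.
move=> Cc nij nlm hp hq hr hs ec; rewrite {}ec in Cc.
have /rowP/(_ t) :=
  packing (ball_two_coords nij hp hq) (ball_two_coords nlm hr hs) Cc.
by rewrite !mxE.
Qed.

Lemma ball_clash c i p j q l r m s t :
    C c -> i <> j -> l <> m -> coef p -> coef q -> coef r -> coef s ->
    c = p *: e i + q *: e j - (r *: e l + s *: e m) ->
    p * (t == i)%:R + q * (t == j)%:R <> r * (t == l)%:R + s * (t == m)%:R ->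
  False.
Proof.
move=> Cc nij nlm hp hq hr hs ec; apply.
exact: ball_eq_coord Cc nij nlm hp hq hr hs ec.
Qed.

Ltac coords :=
  rewrite ?eqxx;
  repeat match goal with
  | |- context [?x == ?y :> 'I_n] => case: (x =P y) => ?
  end; first [exfalso; congruence | lia].

(* Writes the codeword of [H] as a difference of the ball elements
   [p e_i + q e_j] and [r e_l + s e_m], which differ at coordinate [t]. One index
   may occur on both sides, so codeword entries up to [2k - 1] are covered. *)
Ltac clash H i p j q l r m s t :=
  exfalso; apply: (@ball_clash _ i p j q l r m s t H);
  [congruence|congruence|lia|lia|lia|lia|rowring|coords].

(** The support is padded to exactly two indices, so every coefficient except [x] may vanish. When
    [b] vanishes at [i], the padding avoids [i], which [n >= 3] permits. *)
Lemma ball_support b i : ball b ->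
  (exists r x y, [/\ r <> i, x <> 0, coef x, coef y & b = x *: e i + y *: e r])
  \/ (exists r s y z, [/\ r <> s, r <> i, s <> i, coef y &
       coef z /\ b = y *: e r + z *: e s]).
Proof.
case=> hb; rewrite /wt => wb; pose S := [set t | b 0 t != 0].
have hbt t : coef (b 0 t) by have := hb t; lia.
have cS : (#|S| <= 2)%N by rewrite cardsE.
have cD : #|~: [set i]| = n.-1 by rewrite cardsC1 card_ord.
have [bi0|bi0] := boolP (b 0 i == 0).
  have sS : S \subset ~: [set i].
    by apply/subsetP=> t; rewrite !inE; apply: contra => /eqP->.
  have [|S' [sSS' sS' cS']] := @subset_intermediate_card _ _ _ 2 sS.
    by rewrite cD cS; lia.
  have /cards2P[r [s [nrs eS']]] : #|S'| == 2 by rewrite cS'.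
  right; exists r, s, (b 0 r), (b 0 s).
  move: sS'; rewrite eS' subUset !sub1set !inE => /andP[/eqP nri /eqP nsi].
  split=> //; first exact/eqP; split=> //; apply/rowP=> t; rewrite !mxE /=.
  have [->|ntr] := eqVneq t r; first by rewrite (negbTE nrs) mulr1 mulr0 addr0.
  have [->|nts] := eqVneq t s; first by rewrite mulr0 mulr1 add0r.
  rewrite !mulr0 addr0; apply/eqP; apply: contraNT ntr => bt.
  have : t \in S' by apply: (subsetP sSS'); rewrite inE.
  by rewrite eS' !inE (negbTE nts) orbF.
have sS : S :\ i \subset ~: [set i] by rewrite setDE subsetIr.
have [|S' [sSS' sS' cS']] := @subset_intermediate_card _ _ _ 1 sS.
  rewrite cD; have := cardsD1 i S; rewrite inE bi0; lia.
have /cards1P[r eS'] : #|S'| == 1 by rewrite cS'.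
left; exists r, (b 0 i), (b 0 r).
move: sS'; rewrite eS' sub1set !inE => nri; split=> //; [exact/eqP|exact/eqP|].
apply/rowP=> t; rewrite !mxE /=.
have [->|nti] := eqVneq t i; first by rewrite eq_sym (negbTE nri) mulr1 mulr0 addr0.
have [->|ntr] := eqVneq t r; first by rewrite mulr0 mulr1 add0r.
rewrite !mulr0 addr0; apply/eqP; apply: contraNT ntr => bt.
have : t \in S' by apply: (subsetP sSS'); rewrite !inE nti.
by rewrite eS' inE.
Qed.

(* A pair [(j, a)] is doubled or linked (to [l]) at [i] according to the shape
   of the ball element congruent to [- (k e_i + a e_j)]. *)
Definition doubled (i j : 'I_n) (a : int) : Prop :=
  exists r y, [/\ r <> i, coef y & C ((2 * k) *: e i + a *: e j + y *: e r)].

(* When [r <> j], both [l] and [r] carry the coefficient [k]; they cannot both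
   satisfy [2k e_j = k e_r] modulo [C], and the last clause selects the one to
   be called [r], which makes [linked] injective even for [k = 2]. *)
Definition linked (i j : 'I_n) (a : int) (l : 'I_n) : Prop :=
  exists r y, [/\ l <> i, l <> j, r <> i, r <> l &
    C (k *: e i + k *: e l + a *: e j + y *: e r) /\
    ([/\ r = j, a = 1 & y = k - 1 \/ y = k] \/
     [/\ r <> j, y = k & ~ C ((2 * k) *: e j - k *: e r)])].

Lemma linked_of_coord_k i j (a : int) r s y z : j <> i -> a = 1 \/ a = - 1 ->
    r <> s -> r <> i -> s <> i -> coef y -> coef z -> y = k ->
    C (k *: e i + a *: e j + (y *: e r + z *: e s)) ->
  exists l, linked i j a l.
Proof.
move=> nji ha nrs nri nsi hy hz eyk Cb; rewrite {y hy}eyk in Cb.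
wlog nrj : r s z nrs nri nsi hz Cb / r <> j.
  move=> IH; have [erj|/eqP nrj] := eqVneq r j; last exact: (IH r s z).
  rewrite {}erj in nrs nri Cb.
  have [ezk|nzk] := eqVneq z k.
    apply: (IH s j k) => //; [congruence | lia | | congruence].
    by congr C: Cb; rewrite ezk; rowring.
  have {}nzk : z <> k by exact/eqP.
  case: ha => ea; rewrite {}ea in Cb.
    clash Cb i k j k j (-1 : int) s (- z) i.
  clash Cb i k j (k - 1) j (0 : int) s (- z) i.
have [esj|/eqP nsj] := eqVneq s j.
  rewrite {}esj in nrs nsi Cb; exists r, j, z; split=> //; first congruence.
  split; first by congr C: Cb; rowring.
  (* Moved to the other side, [e j] has coefficient [- (a + z)]. It is inadmissible only for [a = 1]
     and [z] equal to [k - 1] or [k]. *)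
  left; have [hz'|hz'] : (z < k - 1 \/ (k - 1 <= z)) by lia.
    by case: ha => ea; rewrite ea in Cb;
       [clash Cb i k r k j (- z - 1) i (0 : int) i
       |clash Cb i k r k j (- z + 1) i (0 : int) i].
  case: ha => ea; first by split=> //; lia.
  rewrite ea in Cb; clash Cb i k r k j (- z + 1) i (0 : int) i.
have [ezk|nzk] := eqVneq z k; last first.
  have {}nzk : z <> k by exact/eqP.
  clash Cb i k r k j (- a) s (- z) i.
rewrite {}ezk in hz Cb.
have [Cs|nCs] := pselect (C ((2 * k) *: e j - k *: e s)).
  exists s, r, k; split=> //.
  split; first by congr C: Cb; rowring.
  right; split=> // Cr; have Crs := latticeB Cr Cs.
  clash Crs s k r (0 : int) r k s (0 : int) s.
exists r, s, k; split=> //; first congruence.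
by split; [congr C: Cb; rowring | right].
Qed.

(** Only [k] is an admissible coefficient with inadmissible negative. Hence if [b] has no
    coefficient [k], enough of it can change sides to contradict packing. A [k] at [i] gives
    doubling, a [k] elsewhere linking. *)
Lemma doubled_or_linked i j (a : int) : j <> i -> a = 1 \/ a = - 1 ->
  doubled i j a \/ exists l, linked i j a l.
Proof.
move=> nji ha; have [b hb Cb] := covering (- (k *: e i + a *: e j)).
have {}Cb : C (k *: e i + a *: e j + b).
  by rewrite -[X in C X]opprK; apply: latticeN; congr C: Cb; rowring.
case: (ball_support i hb) => [[r [x [y [nri nx0 hx hy eb]]]]|].
  rewrite {}eb in Cb.
  have [exk|nxk] := eqVneq x k.
    left; exists r, y; split=> //.
    by congr C: Cb; rewrite exk; rowring.
  have {}nxk : x <> k by exact/eqP.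
  have [erj|/eqP nrj] := eqVneq r j; last first.
    clash Cb i k r y i (- x) j (- a) i.
  rewrite {}erj in Cb.
  have [eyk|nyk] := eqVneq y k; last first.
    have {}nyk : y <> k by exact/eqP.
    clash Cb i k j a i (- x) j (- y) i.
  rewrite eyk in Cb.
  case: ha => ea; rewrite ea in Cb.
    clash Cb i k j k i (- x) j (-1 : int) i.
  clash Cb i k j (k - 1) i (- x) j (0 : int) i.
case=> r [s [y [z [nrs nri nsi hy [hz eb]]]]].
right; rewrite {b hb}eb in Cb.
have [eyk|nyk] := eqVneq y k; first exact: (linked_of_coord_k _ _ nrs _ _ hy hz).
have [ezk|nzk] := eqVneq z k.
  have nsr : s <> r by congruence.
  apply: (linked_of_coord_k _ _ nsr _ _ hz hy) => //.
  by congr C: Cb; rowring.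
have {}nyk : y <> k by exact/eqP.
have {}nzk : z <> k by exact/eqP.
clash Cb i k j a r (- y) s (- z) i.
Qed.

(** Subtracting the two relations cancels [k e_i + k e_l]; the rest is split into two ball elements.
    The helper [mixed] treats links of different kinds. *)
Lemma linked_inj i j j' (a a' : int) l :
    a = 1 \/ a = - 1 -> a' = 1 \/ a' = - 1 ->
  linked i j a l -> linked i j' a' l -> j = j' /\ a = a'.
Proof.
have mixed j1 j2 (a1 a2 : int) r y r2 y2 : a1 = 1 \/ a1 = -1 -> l <> j1 ->
    C (k *: e i + k *: e l + a1 *: e j1 + y *: e r) ->
    C (k *: e i + k *: e l + a2 *: e j2 + y2 *: e r2) ->
    [/\ r2 = j2, a2 = 1 & y2 = k - 1 \/ y2 = k] ->
    [/\ r <> j1, y = k & ~ C ((2 * k) *: e j1 - k *: e r)] -> False.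
  move=> ha1 nl1 C1 C2 [er2 ea2 hy2] [nr1 eyk nC].
  rewrite {}er2 {}ea2 in C2; rewrite {}eyk in C1.
  have Cd := latticeB C1 C2.
  have [e2r|/eqP n2r] := eqVneq j2 r.
    rewrite e2r in Cd.
    clash Cd j1 a1 r (k - (1 + y2)) j1 (0 : int) r (0 : int) j1.
  have [e21|/eqP n21] := eqVneq j2 j1; last first.
    clash Cd r k j2 (k - (1 + y2)) j2 k j1 (- a1) r.
  rewrite e21 in Cd.
  (* The left side is at most [k + 2], so [big] occurs only for [k = 2]; the relation is then the
     one excluded by [nC]. *)
  have [big|small] : (1 + y2 - a1 = 2 * k \/ 1 + y2 - a1 <= 2 * k - 1) by lia.
    have Cd' := latticeN Cd.
    apply: nC; congr C: Cd'; rewrite -big; rowring.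
  clash Cd j1 (k - (1 + y2 - a1)) r k j1 k r (0 : int) r.
move=> ha ha' [r [y [nli nlj nri nrl [C1 h1]]]].
move=> [r' [y' [nli' nlj' nri' nrl' [C2 h2]]]].
have Cd := latticeB C1 C2.
case: h1 h2 => [h1|h1] [h2|h2].
- case: h1 C1 Cd => -> -> hy C1 Cd; case: h2 C2 Cd => -> -> hy' C2 Cd.
  split=> //; have [//|/eqP njj] := eqVneq j j'.
  clash Cd j k j' (k - (1 + y')) j (k - (1 + y)) j' k j.
- by case: (mixed _ _ _ _ _ _ _ _ _ _ C2 C1 h1 h2).
- by case: (mixed _ _ _ _ _ _ _ _ _ _ C1 C2 h2 h1).
case: h1 C1 Cd => nrj -> _ C1 Cd; case: h2 C2 Cd => nrj' -> _ C2 Cd.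
have [ejj|/eqP njj] := eqVneq j j'; last first.
  clash Cd j a r k j' a' r' k j.
split=> //; rewrite -ejj in nrj' Cd.
have [//|/eqP naa] := eqVneq a a'.
clash Cd j a r k j a' r' k j.
Qed.

(** * Counting doubled pairs *)

(** Booleans encode the signs so that the pairs [(j, a)] form a finite type. *)
Definition sign_of (b : bool) : int := if b then 1 else - 1.

Lemma sign_ofP b : sign_of b = 1 \/ sign_of b = - 1.
Proof. by case: b; [left|right]. Qed.

Lemma sign_of_inj : injective sign_of.
Proof. by case=> [] []. Qed.

(** Axial pairs are those with [r = j]; they all share one index. If both signs are axial there, no
    other index occurs. Otherwise at most one pair is axial, and all remaining pairs come from the
    unique ball element congruent to [-2k e_i], whose two terms give at most two pairs. *)
Lemma card_doubled i : ~ C ((2 * k) *: e i) ->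
  (#|[set p : 'I_n * bool |
       (p.1 != i) && `[< doubled i p.1 (sign_of p.2) >]]| <= 3)%N.
Proof.
move=> hi; set S := [set p | _].
pose axial := [set p in S | `[< exists y, coef y /\
  C ((2 * k) *: e i + (sign_of p.2 + y) *: e p.1) >]].
have axial_coord p q : p \in axial -> q \in axial -> p.1 = q.1.
  rewrite ![_ \in axial]inE.
  move=> /andP[_ /asboolP[y [hy Cp]]] /andP[_ /asboolP[z [hz Cq]]].
  have [//|/eqP npq] := eqVneq p.1 q.1; have Cd := latticeB Cp Cq.
  have hv : sign_of p.2 + y <> 0.
    by move=> v0; apply: hi; congr C: Cp; rewrite v0 scale0r addr0.
  have := sign_ofP p.2; have := sign_ofP q.2; move: hv Cd.
  move: (sign_of p.2) (sign_of q.2) => a b hv Cd hb ha.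
  (* As [a + y] lies between [-k] and [k + 1], it is a difference of two admissible coefficients;
     here [k >= 2] matters. *)
  have [p1 [p2 [ep h1 h2]]] : exists p1 p2,
      [/\ a + y = p1 - p2, coef p1 & coef p2].
    have [pos|neg] : 0 < a + y \/ a + y < 0 by lia.
      by exists k, (k - (a + y)); split; lia.
    by exists (a + y + k), k; split; lia.
  have [q1 [q2 [eq h3 h4]]] : exists p1 p2,
      [/\ b + z = p1 - p2, coef p1 & coef p2].
    have [pos|neg] : 0 <= b + z \/ b + z < 0 by lia.
      by exists k, (k - (b + z)); split; lia.
    by exists (b + z + k), k; split; lia.
  rewrite ep eq in Cd.
  clash Cd p.1 p1 q.1 q2 p.1 p2 q.1 q1 p.1.
have offaxis p : p \in S -> p \notin axial -> exists r y, [/\ r <> p.1, coef y &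
    C ((2 * k) *: e i + sign_of p.2 *: e p.1 + y *: e r)].
  move=> pS; rewrite inE pS /= => nax.
  move: pS; rewrite inE => /andP[_ /asboolP[r [y [_ hy Cp]]]].
  move: nax => /asboolPn nax; exists r, y; split=> // er; apply: nax.
  by exists y; split=> //; congr C: Cp; rewrite er; rowring.
have offaxis_axial p j : p \in S -> p \notin axial -> (j, true) \in axial ->
    (j, false) \in axial -> p.1 = j.
  move=> pS nap; have [r [y [nr hy Cp]]] := offaxis _ pS nap.
  rewrite ![_ \in axial]inE /=.
  move=> /andP[_ /asboolP[z [hz Ct]]] /andP[_ /asboolP[w [hw Cf]]].
  have [//|/eqP npj] := eqVneq p.1 j.
  have hs := sign_ofP p.2; move: (sign_of p.2) hs Cp => a ha Cp.
  have Ctp := latticeB Ct Cp; have Cpf := latticeB Cp Cf.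
  (* Packing leaves only the extreme values of [z] and [w], where the coefficients [k + 1] and [-k]
     of [e j] just leave the admissible range. *)
  have [zlt|zk] : z < k \/ z = k by lia.
    clash Ctp j (1 + z) p.1 (0 : int) p.1 a r y p.1.
  have [wgt|wk] : - (k - 1) < w \/ w = - (k - 1) by lia.
    clash Cpf p.1 a r y j (- 1 + w) p.1 (0 : int) p.1.
  rewrite zk in Ctp; rewrite wk in Cpf.
  have [erj|/eqP nrj] := eqVneq r j.
    rewrite erj in Ctp Cpf.
    have [yk|yk] : y < k \/ y = k by lia.
      clash Cpf j k p.1 a j (- y) p.1 (0 : int) p.1.
    rewrite yk in Ctp.
    clash Ctp j (1 : int) p.1 (0 : int) j (0 : int) p.1 a p.1.
  have [yk|yk] : y < k \/ y = k by lia.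
    clash Cpf j k p.1 a r (- y) p.1 (0 : int) p.1.
  rewrite yk in Cpf.
  clash Cpf j k r k p.1 (- a) j (0 : int) j.
have c2 (j : 'I_n) : #|[set (j, true); (j, false)]| = 2.
  by rewrite cards2 xpair_eqE andbF.
have [[j [jt jf]]|nboth] :=
    pselect (exists j, (j, true) \in axial /\ (j, false) \in axial).
  suff: S \subset [set (j, true); (j, false)].
    by move=> /subset_leq_card; rewrite c2; lia.
  apply/subsetP=> p pS; have -> : p = (j, p.2).
    case: p pS => p1 p2 pS /=; congr (_, _).
    have [pa|npa] := boolP ((p1, p2) \in axial).
      by have := axial_coord _ _ pa jt.
    exact: (offaxis_axial _ _ pS npa jt jf).
  by rewrite !inE !xpair_eqE eqxx /=; case: p.2.
have cax : (#|axial| <= 1)%N.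
  apply/card_le1_eqP => p q pa qa; have epq := axial_coord _ _ pa qa.
  have nb j : (j, true) \in axial -> (j, false) \in axial -> False.
    by move=> jt jf; apply: nboth; exists j.
  case: p q pa qa epq => [p1 []] [q1 []] /= pa qa epq; rewrite epq // in pa *.
    by case: (nb q1).
  by case: (nb q1).
have coff : (#|S :\: axial| <= 2)%N.
  have [->|[p0]] := set_0Vmem (S :\: axial); first by rewrite cards0.
  rewrite inE => /andP[na0 p0S]; have [r [y [nr hy Cp0]]] := offaxis _ p0S na0.
  (* Any other pair must read the same ball element from its term [y e_r], so [y] is a sign, encoded
     by [y == 1]. *)
  suff sub : S :\: axial \subset [set p0; (r, y == 1)].
    by apply: leq_trans (subset_leq_card sub) _; rewrite cards2; case: eqP.
  apply/subsetP=> p; rewrite inE => /andP[na pS].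
  have [s [z [ns hz Cp]]] := offaxis _ pS na.
  have hp := sign_ofP p.2; have hp0 := sign_ofP p0.2.
  have : sign_of p.2 * (p.1 == p.1)%:R + z * (p.1 == s)%:R =
      sign_of p0.2 * (p.1 == p0.1)%:R + y * (p.1 == r)%:R.
    apply: (ball_eq_coord p.1 (latticeB Cp Cp0));
      by [congruence | lia | rowring].
  rewrite eqxx (introF eqP (not_eq_sym ns)) mulr1 mulr0 addr0.
  case: p {na pS Cp hp} ns => [p1 p2] /= ns; rewrite !inE.
  case: p0 {na0 p0S Cp0 hp0} nr => [q1 q2] /= nr; rewrite !xpair_eqE.
  have [->|_] := eqVneq p1 q1.
    rewrite (introF eqP (not_eq_sym nr)) mulr1 mulr0 addr0 => /sign_of_inj->.
    by rewrite eqxx.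
  have [_|_] := eqVneq p1 r; rewrite ?mulr0 ?mulr1 ?add0r /=.
    by move=> <-; case: p2.
  by case: p2.
have cI : (#|S :&: axial| <= 1)%N.
  by apply: leq_trans cax; apply/subset_leq_card/subsetIr.
by rewrite -(cardsID axial S); lia.
Qed.

(** * The lower bound on the dimension *)

(** The map [x -> 1 - x] preserves the coefficient range, so a term of [b] at [i1] is absorbed into
    [e i1]; moving [e i3] across then contradicts packing. *)
Lemma coord_eq0_of_cover (i1 i2 i3 : 'I_n) b :
  i1 <> i2 -> i1 <> i3 -> i2 <> i3 ->
  ball b -> C (e i1 + e i2 + e i3 - b) -> b 0 i1 = 0.
Proof.
move=> n12 n13 n23 hb Cb.
case: (ball_support i1 hb) => [[r [x [y [nri nx0 hx hy eb]]]]|].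
  rewrite eb in Cb.
  have [er2|/eqP nr2] := eqVneq r i2.
    rewrite er2 in Cb.
    clash Cb i1 (1 - x) i2 (1 - y) i3 (-1 : int) i1 (0 : int) i3.
  have [er3|/eqP nr3] := eqVneq r i3.
    rewrite er3 in Cb.
    clash Cb i1 (1 - x) i3 (1 - y) i2 (-1 : int) i1 (0 : int) i2.
  clash Cb i1 (1 - x) i2 (1 : int) i3 (-1 : int) r y i2.
case=> r [s [y [z [nrs nri nsi hy [hz ->]]]]]; rewrite !mxE /=.
by coords.
Qed.

Lemma five_coords (i1 i2 i3 : 'I_n) :
  i1 <> i2 -> i1 <> i3 -> i2 <> i3 -> (5 <= n)%N.
Proof.
move=> n12 n13 n23; have [b hb Cb] := covering (e i1 + e i2 + e i3).
have b1 := coord_eq0_of_cover n12 n13 n23 hb Cb.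
have b2 : b 0 i2 = 0.
  apply: (@coord_eq0_of_cover i2 i1 i3) => //; try congruence.
  by congr C: Cb; rowring.
have b3 : b 0 i3 = 0.
  apply: (@coord_eq0_of_cover i3 i1 i2) => //; try congruence.
  by congr C: Cb; rowring.
case: (ball_support i1 hb) => [[r [x [y [nri nx0 hx hy eb]]]]|].
  by case: nx0; move: b1; rewrite eb !mxE; coords.
case=> r [s [y [z [nrs nri nsi hy [hz eb]]]]].
have br : b 0 r = y by rewrite eb !mxE /=; coords.
have bs : b 0 s = z by rewrite eb !mxE /=; coords.
(* Excludes weight at most one: [e i1 + e i2] would be congruent to [x e_t - e_i3]. *)
have wt1 t x : coef x -> t <> i1 -> b 0 t = x -> b = x *: e t -> False.
  move=> hx nt1 bt eb'; rewrite eb' in Cb.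
  have [et3|/eqP nt3] := eqVneq t i3; last first.
    clash Cb i1 (1 : int) i2 (1 : int) i3 (-1 : int) t x i1.
  have x0 : x = 0 by rewrite -bt et3.
  rewrite x0 in Cb.
  clash Cb i1 (1 : int) i2 (1 : int) i3 (-1 : int) i1 (0 : int) i2.
have y0 : y <> 0.
  by move=> y0; apply: (wt1 s z) => //; rewrite eb y0; rowring.
have z0 : z <> 0.
  by move=> z0; apply: (wt1 r y) => //; rewrite eb z0; rowring.
have n2r : i2 <> r by move=> E; apply: y0; rewrite -br -E.
have n3r : i3 <> r by move=> E; apply: y0; rewrite -br -E.
have n2s : i2 <> s by move=> E; apply: z0; rewrite -bs -E.
have n3s : i3 <> s by move=> E; apply: z0; rewrite -bs -E.
have uni : uniq [:: i1; i2; i3; r; s].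
  rewrite /= !inE !negb_or !andbT; repeat (apply/andP; split);
  apply/eqP; congruence.
have := max_card (mem [:: i1; i2; i3; r; s]).
by rewrite (card_uniqP uni) card_ord.
Qed.

(** * The multiples [2k e_i] and the final contradiction *)

Lemma not_all_lattice_2k (i1 i2 i3 : 'I_n) : i1 <> i2 -> i1 <> i3 -> i2 <> i3 ->
  ~ forall i, C ((2 * k) *: e i).
Proof.
move=> n12 n13 n23 hC; have [b hb Cb] := covering (e i1 + e i2 + 2 *: e i3).
have fin u v : coef u -> coef v ->
    C ((1 - u) *: e i1 + (1 - v) *: e i2 + 2 *: e i3) -> False.
  (* For [v = 1 - k] the coefficient [v - 1 = -k] is inadmissible; the codeword [2k e_i2] changes it
     to [k]. *)
  move=> hu hv Cuv; have [vgt|ev] : 1 - k < v \/ v = 1 - k by lia.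
    clash Cuv i1 (1 - u) i3 (2 : int) i2 (v - 1) i1 (0 : int) i3.
  rewrite ev in Cuv; have Cd := latticeB Cuv (hC i2).
  clash Cd i1 (1 - u) i3 (2 : int) i2 k i1 (0 : int) i3.
have even_odd (x : int) : exists m d : int, (d = 0 \/ d = 1) /\ x = d + 2 * m.
  by exists (x %/ 2)%Z, (x %% 2)%Z; split; lia.
have fin2 r s y z : r <> s -> coef y -> coef z ->
    b = y *: e r + z *: e s -> False.
  move=> nrs hy hz eb.
  have [m [d [hd ey]]] := even_odd y; have [q [f [hf ez]]] := even_odd z.
  (* After multiplication by [k], the even parts of [y] and [z] and the term at [i3] are codewords;
     only the parities [d] and [f] survive. *)
  have Ck : C (k *: e i1 + k *: e i2 - ((d * k) *: e r + (f * k) *: e s)).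
    have Cm := latticeD (latticeZ m (hC r)) (latticeZ q (hC s)).
    have := latticeD (latticeZ k Cb) (latticeB Cm (hC i3)).
    by congr C; rewrite eb ey ez; rowring.
  have hdk : coef (d * k) by case: hd => ->; lia.
  have hfk : coef (f * k) by case: hf => ->; lia.
  have [e1r|/eqP n1r] := eqVneq i1 r.
    have [e2s|/eqP n2s] := eqVneq i2 s.
      by apply: (fin y z) => //; congr C: Cb; rewrite eb -e1r -e2s; rowring.
    clash Ck i1 k i2 k r (d * k) s (f * k) i2.
  have [e1s|/eqP n1s] := eqVneq i1 s; last first.
    clash Ck i1 k i2 k r (d * k) s (f * k) i1.
  have [e2r|/eqP n2r] := eqVneq i2 r.
    by apply: (fin z y) => //; congr C: Cb; rewrite eb -e1s -e2r; rowring.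
  clash Ck i1 k i2 k r (d * k) s (f * k) i2.
case: (ball_support i3 hb) => [[r [x [y [nri _ hx hy eb]]]]|].
  by apply: (fin2 i3 r x y) => //; congruence.
by case=> r [s [y [z [nrs _ _ hy [hz eb]]]]]; apply: (fin2 r s y z).
Qed.

Lemma lattice_2k i : (5 <= n)%N -> C ((2 * k) *: e i).
Proof.
move=> n5; apply: contrapT => hi.
pose S1 := [set p : 'I_n * bool |
  (p.1 != i) && `[< doubled i p.1 (sign_of p.2) >]].
pose S2 := [set p : 'I_n * bool |
  (p.1 != i) && `[< exists l, linked i p.1 (sign_of p.2) l >]].
have c1 : (#|S1| <= 3)%N := card_doubled hi.
have c2 : (#|S2| <= n.-1)%N.
  have ex_l p : exists l, p \in S2 -> linked i p.1 (sign_of p.2) l.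
    (* Outside [S2] the value [i] is a dummy; injectivity and avoidance of [i] concern [S2] only. *)
    have [|npS] := boolP (p \in S2); last by exists i.
    by rewrite inE => /andP[_ /asboolP[l hl]]; exists l.
  have [f fP] := boolp.choice ex_l.
  have finj : {in S2 &, injective f}.
    move=> [p1 p2] [q1 q2] pS qS epq; have := fP _ qS; rewrite -epq => hq.
    have := linked_inj (sign_ofP _) (sign_ofP _) (fP _ pS) hq.
    by case=> /= -> /sign_of_inj->.
  rewrite -(card_in_imset finj) -[n in n.-1]card_ord -(cardsC1 i).
  apply/subset_leq_card/subsetP=> _ /imsetP[p pS ->].
  by rewrite !inE; apply/eqP; have [r [y [? _ _ _ _]]] := fP _ pS.
have c3 : #|setX [set~ i] [set: bool]| = (n.-1 * 2)%N.
  by rewrite cardsX cardsC1 card_ord cardsT card_bool.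
have : setX [set~ i] [set: bool] \subset S1 :|: S2.
  apply/subsetP=> p; rewrite !inE andbT => npi; rewrite npi /=.
  apply/orP; case: (doubled_or_linked (elimN eqP npi) (sign_ofP p.2)) => h;
    by [left; apply/asboolP | right; apply/asboolP].
move=> /subset_leq_card; rewrite c3 cardsU => le12.
have := leq_trans le12 (leq_trans (leq_subr _ _) (leq_add c1 c2)).
lia.
Qed.

Lemma no_such_lattice : False.
Proof.
have n0 : (0 < n)%N by lia.
have n1 : (1 < n)%N by lia.
pose i1 := Ordinal n0; pose i2 := Ordinal n1; pose i3 := Ordinal hn.
have [n12 n13 n23] : [/\ i1 <> i2, i1 <> i3 & i2 <> i3] by [].
apply: (not_all_lattice_2k n12 n13 n23) => i.
exact/lattice_2k/(five_coords n12 n13 n23).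
Qed.

End LatticeTiling.

Theorem theorem1p2 (n : nat) (k : int) (hn : (3 <= n)%N) (hk : 2 <= k) :
  ~ exists C : set 'rV[int]_n, lattice_tiling (error_ball n 2 k (k - 1)) C.
Proof.
case=> C [[covC trivC _] [/set_mem Cz memB]].
have latticeB x y : C x -> C y -> C (x - y).
  by move=> Cx Cy; apply: set_mem; apply: memB; apply: mem_set.
apply: (@no_such_lattice n k C hn hk latticeB).
- move=> z; have : classical_sets.setT z by [].
  rewrite -covC => -[c Cc [b hb <-]]; exists b => //.
  by rewrite addrC addKr.
- move=> x y hx hy Cxy.
  (* The point [x] lies in the translates by [0] and by [x - y], so these indices coincide. *)
  have /(_ _)/esym/subr0_eq := trivC _ _ Cz Cxy; apply; exists x; split.
    by exists x; rewrite ?addr0.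
  by exists y; rewrite // addrC subrK.
Qed.
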